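(* Even if the chase of a rule set $\mathcal{R}$ terminates, the chase of the TGD set $\mathsf{St}(\mathcal{R})$ may not.
   Context: Rules are function- and constant-free first-order formulas of two kinds: tuple generating dependencies (TGDs) $\forall \vec{x},\vec{y}.(\beta[\vec{x},\vec{y}] \to \exists \vec{w}.\eta[\vec{x},\vec{w}])$ and equality generating dependencies (EGDs) $\forall \vec{x}.(\beta[\vec{x}] \to x \approx y)$ with $x,y \in \vec{x}$, where $\beta,\eta$ are non-empty conjunctions of equality-free atoms. The (non-oblivious, Skolem) chase on an ontology $\langle\mathcal{R},\mathcal{F}\rangle$ starts from the fact set $\mathcal{F}$; a TGD with body match $\sigma$ is applicable if no extension of $\sigma$ maps its head into the current set and then adds its head with existential variables $w$ replaced by Skolem terms $f_w(\sigma(\vec{x}))$; an EGD with body match $\sigma$ and $\sigma(x)\neq\sigma(y)$ merges the two terms (deeper into shallower by a fixed total order compatible with depth). Chase sequences must be fair. The chase of a rule set $\mathcal{R}$ terminates if for every fact set $\mathcal{F}$ all chase sequences of $\langle\mathcal{R},\mathcal{F}\rangle$ are finite. The standard axiomatisation $\mathsf{St}(\mathcal{R})$ keeps the TGDs of $\mathcal{R}$, replaces each EGD $\beta\to x\approx y$ by $\beta\to\mathsf{EQ}(x,y)$ for a fresh binary predicate $\mathsf{EQ}$, and adds reflexivity rules $P(x_1,\ldots,x_n)\to\bigwedge_i\mathsf{EQ}(x_i,x_i)$ for every predicate $P\neq\approx$ of $\mathcal{R}$, symmetry $\mathsf{EQ}(x,y)\to\mathsf{EQ}(y,x)$, transitivity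 $\mathsf{EQ}(x,y)\wedge\mathsf{EQ}(y,z)\to\mathsf{EQ}(x,z)$, and replacement rules $P(x_1,\ldots,x_n)\wedge\mathsf{EQ}(x_i,x_i')\to P(x_1,\ldots,x_n)[x_i/x_i']$ for every such $P$ and position $i$. *)

(* Defs.v *)
From HB Require Import structures.
From mathcomp Require Import all_boot finmap.

Set Implicit Arguments.
Unset Strict Implicit.
Unset Printing Implicit Defensive.

Local Open Scope fset_scope.

(* [(s, n)] is the predicate with name [s] and arity [n.+1]: arities are
   positive, and there are infinitely many predicates of each arity. *)
Definition pred_sym := (nat * nat)%type.
Definition arity (P : pred_sym) : nat := P.2.+1.

Definition atom (T : Type) := {P : pred_sym & (arity P).-tuple T}.

Definition mk_atom T (P : pred_sym) (ts : (arity P).-tuple T) : atom T :=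
  Tagged (fun Q => (arity Q).-tuple T) ts.

Definition args T (a : atom T) : seq T := tagged a.

Definition map_atom T U (f : T -> U) (a : atom T) : atom U :=
  mk_atom (map_tuple f (tagged a)).

Definition var := nat.

Definition vars (A : seq (atom var)) : seq var := flatten (map (@args var) A).

(* A TGD is the pair (body, head); its quantifiers are implicit, see
   [frontier] and [existential]. *)
Definition tgd := (seq (atom var) * seq (atom var))%type.

(* The EGD [(B, (x, y))] is B -> x = y. *)
Definition egd := (seq (atom var) * (var * var))%type.

Definition rule := (tgd + egd)%type.

Definition body (r : rule) : seq (atom var) :=
  match r with inl d => d.1 | inr d => d.1 end.

Definition wf_rule (r : rule) : bool :=
  match r with
  | inl (B, H) => (B != [::]) && (H != [::])
  | inr (B, (x, y)) => [&& B != [::], x \in vars B & y \in vars B]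
  end.

Definition frontier (d : tgd) : seq var :=
  [seq x <- undup (vars d.1) | x \in vars d.2].

Definition existential (d : tgd) : seq var :=
  [seq w <- undup (vars d.2) | w \notin vars d.1].

(* The Skolem symbol f_w of an existential variable w carries its TGD, so that
   distinct TGDs never share a symbol even if they share variable names. *)
Definition skolem := (tgd * var)%type.

Inductive term : Type :=
  | Const of nat
  | Sk of skolem & seq term.

Fixpoint depth (t : term) : nat :=
  match t with
  | Const _ => 0
  | Sk _ ts => (foldr maxn 0 (map depth ts)).+1
  end.

Definition is_const (t : term) : bool := if t is Const _ then true else false.

Fixpoint term_encode (t : term) : GenTree.tree nat :=
  match t with
  | Const c => GenTree.Leaf c
  | Sk f ts => GenTree.Node (choice.pickle f) (map term_encode ts)
  end.

Fixpoint term_decode (t : GenTree.tree nat) : term :=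
  match t with
  | GenTree.Leaf c => Const c
  | GenTree.Node n ts =>
      if choice.unpickle n is Some f then Sk f (map term_decode ts) else Const 0
  end.

Lemma term_encodeK : cancel term_encode term_decode.
Proof.
rewrite /cancel; fix IH 1; case=> [c|f ts] //=; rewrite choice.pickleK; congr Sk.
by elim: ts => //= t ts ->; rewrite IH.
Qed.

HB.instance Definition _ := Countable.copy term (can_type term_encodeK).

Definition fact := atom term.

Definition fact_set := {fset fact}.

(* Initial fact sets contain no Skolem terms. *)
Definition function_free (F : fact_set) : Prop :=
  forall a, a \in F -> all is_const (args a).

Definition term_order (prec : rel term) : Prop :=
  [/\ irreflexive prec,
      transitive prec,
      forall t u, t != u -> prec t u || prec u t
    & forall t u, depth t < depth u -> prec t u].

Lemma term_order_exists : exists prec, term_order prec.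
Proof.
pose code (t : term) : nat := choice.pickle t.
have code_inj : injective code by exact: pcan_inj choice.pickleK.
exists (fun t u => (depth t < depth u) ||
          (depth t == depth u) && (code t < code u)); split.
- by move=> t; rewrite !ltnn andbF.
- move=> u t v /orP[tu|/andP[/eqP-> tu]] /orP[uv|/andP[/eqP<- uv]].
  + by rewrite (ltn_trans tu uv).
  + by rewrite tu.
  + by rewrite uv.
  + by rewrite eqxx (ltn_trans tu uv) orbT.
- move=> t u; case: (ltngtP (depth t)) => //= _.
  by rewrite -neq_ltn (inj_eq code_inj).
- by move=> t u ->.
Qed.

(* Substitutions are total; only their values on the variables of the rule at
   hand matter. *)
Definition subst := var -> term.

Definition inst (s : subst) (A : seq (atom var)) : fact_set :=
  [fset map_atom s a | a in A].

Definition applicable (F : fact_set) (r : rule) (s : subst) : Prop :=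
  inst s (body r) `<=` F /\
  match r with
  | inl (B, H) =>
      ~ exists s' : subst, {in vars B, s' =1 s} /\ inst s' H `<=` F
  | inr (_, (x, y)) => s x != s y
  end.

Definition skolem_ext (d : tgd) (s : subst) : subst := fun v =>
  if v \in existential d then Sk (d, v) (map s (frontier d)) else s v.

(* Skolem terms behave as labelled nulls: [t] is replaced where it is an
   argument of a fact, not where it is nested inside another term. *)
Definition replace (t u : term) (F : fact_set) : fact_set :=
  [fset map_atom (fun v => if v == t then u else v) a | a in F].

Definition merge (prec : rel term) (t u : term) (F : fact_set) : fact_set :=
  if prec t u then replace u t F else replace t u F.

Definition apply_rule (prec : rel term) (F : fact_set) (r : rule) (s : subst) :
    fact_set :=
  match r with
  | inl d => F `|` inst (skolem_ext d s) d.2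
  | inr (_, (x, y)) => merge prec (s x) (s y) F
  end.

(* The length [Some n] stands for the finite sequence F 0, ..., F n, and [None]
   for the infinite sequence F 0, F 1, ... *)
Definition in_range (len : option nat) (i : nat) : bool :=
  if len is Some n then i <= n else true.

(* For a finite sequence, the fairness clause says that no rule is applicable
   to its last element. *)
Definition chase_sequence (prec : rel term) (R : seq rule) (F0 : fact_set)
    (len : option nat) (F : nat -> fact_set) : Prop :=
  [/\ F 0 = F0,
      forall i, in_range len i.+1 ->
        exists r s, [/\ r \in R, applicable (F i) r s
                      & F i.+1 = apply_rule prec (F i) r s]
    & forall r s i, r \in R -> in_range len i -> applicable (F i) r s ->
        exists j, [/\ i <= j, in_range len j & ~ applicable (F j) r s]].

Definition chase_terminates (prec : rel term) (R : seq rule) : Prop :=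
  forall F0 len F, function_free F0 -> chase_sequence prec R F0 len F ->
    exists n, len = Some n.

Definition rule_atoms (r : rule) : seq (atom var) :=
  match r with inl d => d.1 ++ d.2 | inr d => d.1 end.

Definition preds (R : seq rule) : seq pred_sym :=
  undup [seq tag a | a <- flatten (map rule_atoms R)].

Definition binary (e : nat) : pred_sym := (e, 1).

Definition EQ (e : nat) (x y : var) : atom var :=
  @mk_atom var (binary e) [tuple x; y].

(* P(x_0, ..., x_(n-1)), where x_i is the variable i. *)
Definition generic_atom (P : pred_sym) : atom var :=
  mk_atom [tuple val i | i < arity P].

Definition refl_rule (e : nat) (P : pred_sym) : rule :=
  inl ([:: generic_atom P], [seq EQ e i i | i <- iota 0 (arity P)]).

Definition sym_rule (e : nat) : rule := inl ([:: EQ e 0 1], [:: EQ e 1 0]).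

Definition trans_rule (e : nat) : rule :=
  inl ([:: EQ e 0 1; EQ e 1 2], [:: EQ e 0 2]).

(* The variable [arity P], not used in [generic_atom P], plays x_i'. *)
Definition replacement_rule (e : nat) (P : pred_sym) (i : nat) : rule :=
  inl ([:: generic_atom P; EQ e i (arity P)],
       [:: map_atom (fun v => if v == i then arity P else v) (generic_atom P)]).

Definition relax (e : nat) (r : rule) : rule :=
  match r with
  | inl d => inl d
  | inr (B, (x, y)) => inl (B, [:: EQ e x y])
  end.

Lemma fresh_binary (R : seq rule) : exists e, binary e \notin preds R.
Proof.
exists (\max_(P <- preds R) P.1).+1; apply/negP => eR.
by have := @leq_bigmax_seq _ _ xpredT (fun P : pred_sym => P.1) _ eR isT; rewrite ltnn.
Qed.

(* Meant for [e] such that [binary e] does not occur in [R]. *)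
Definition St (e : nat) (R : seq rule) : seq rule :=
  map (relax e) R
  ++ map (refl_rule e) (preds R)
  ++ [:: sym_rule e; trans_rule e]
  ++ [seq replacement_rule e P i | P <- preds R, i <- iota 0 (arity P)].

(* Main.v *)
(* The rule set is A(x) -> exists w. P(x, w) together with P(x, y) -> x = y.
   Its chase terminates: a TGD step gives a P-successor to an A-term that had
   none and creates one null, while an EGD step removes a term and creates no
   A-term without P-successor, so that twice the number of such A-terms plus the
   number of all terms decreases.
   In the axiomatised rule set the null t_1 created from A(t_0) is never merged:
   EQ(t_0, t_1) yields A(t_1) by replacement, hence the TGD applies to t_1 as
   long as no fact P(t_1, _) has been derived, and so on. The chase sequence
   creates t_(n+1) from t_n and only then derives the facts P(t_n, _) that would
   have satisfied the TGD at t_n. It is fair because every A-, P- and EQ-fact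
   over the t_i is eventually derived, and these facts together satisfy all
   the rules. *)
Require Import Defs.
From HB Require Import structures.
From mathcomp Require Import all_boot finmap.
From mathcomp Require Import zify.

Set Implicit Arguments.
Unset Strict Implicit.
Unset Printing Implicit Defensive.

Local Open Scope fset_scope.

(** * Unary and binary atoms, and instances of conjunctions *)

Definition at1 T (x : T) : atom T := @mk_atom T (0, 0) [tuple x].
(** With [at1] for A, [at2 0] for P and [at2 e] for EQ, these two cover all atoms of the example, in
    rules as well as in facts. *)
Definition at2 T (p : nat) (x y : T) : atom T :=
  @mk_atom T (binary p) [tuple x; y].

Lemma atom_inj T (a b : atom T) : tag a = tag b -> args a = args b -> a = b.
Proof.
case: a => P u; case: b => Q v /= PQ; subst Q; rewrite /args /= => uv.
by congr Tagged; apply: val_inj.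
Qed.

Lemma args_map_atom T U (f : T -> U) a : args (map_atom f a) = map f (args a).
Proof. by []. Qed.

Lemma map_at1 T U (f : T -> U) x : map_atom f (at1 x) = at1 (f x).
Proof. exact: atom_inj. Qed.

Lemma map_at2 T U (f : T -> U) p x y :
  map_atom f (at2 p x y) = at2 p (f x) (f y).
Proof. exact: atom_inj. Qed.

Lemma at1P T (a : atom T) : tag a = (0, 0) -> exists x, a = at1 x.
Proof.
case: a => P u /= E; subst P; case/tupleP: u => x u; exists x.
by apply: atom_inj; rewrite // /args /= tuple0.
Qed.

Lemma at2P T (a : atom T) p :
  tag a = binary p -> exists x y, a = at2 p x y.
Proof.
case: a => P u /= E; subst P; case/tupleP: u => x u; case/tupleP: u => y u.
by exists x, y; apply: atom_inj; rewrite // /args /= tuple0.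
Qed.

Lemma generic_at1 : generic_atom (0, 0) = at1 0.
Proof.
by apply: atom_inj => //; rewrite /args /= -[LHS]/(map val (enum 'I_1)) val_enum_ord.
Qed.

Lemma generic_at2 p : generic_atom (binary p) = at2 p 0 1.
Proof.
by apply: atom_inj => //; rewrite /args /= -[LHS]/(map val (enum 'I_2)) val_enum_ord.
Qed.

Lemma inst_subP (s : subst) A (F : fact_set) :
  reflect {in A, forall a, map_atom s a \in F} (inst s A `<=` F).
Proof.
apply: (iffP idP) => [/fsubsetP sub a aA|sub].
  by apply: sub; apply: in_imfset.
by apply/fsubsetP => _ /imfsetP[a /= aA ->]; apply: sub.
Qed.

(** * The rule set and the termination of its chase *)

Definition witness_tgd : tgd := ([:: at1 0], [:: at2 0 0 1]).
Definition collapse_egd : egd := ([:: at2 0 0 1], (0, 1)).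
Definition witness_rules : seq rule := [:: inl witness_tgd; inr collapse_egd].

(** Only arguments of facts count, not subterms nested in them, in accordance with [replace]. *)
Definition terms (F : fact_set) : {fset term} :=
  [fset x in flatten (map (@args term) F)].

Lemma termsP F x : reflect (exists2 a, a \in F & x \in args a) (x \in terms F).
Proof. rewrite !inE; exact: flatten_mapP. Qed.

(** Arities are positive, so the default [Const 0] is never returned. *)
Definition firsts (P : pred_sym) (F : fact_set) : {fset term} :=
  [fset head (Const 0) (args a) | a in F & tag a == P].

Lemma firstsP P F x :
  reflect (exists a, [/\ a \in F, tag a = P & x = head (Const 0) (args a)])
          (x \in firsts P F).
Proof.
apply: (iffP idP) => [/imfsetP[a /=]|[a [aF aP ->]]].
  by rewrite inE => /andP[aF /eqP aP] ->; exists a.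
by apply/imfsetP; exists a => //=; rewrite inE aF aP eqxx.
Qed.

Lemma firsts_sub P F G : F `<=` G -> firsts P F `<=` firsts P G.
Proof.
move=> /fsubsetP FG; apply/fsubsetP => x /firstsP[a [aF aP ->]].
by apply/firstsP; exists a; split=> //; apply: FG.
Qed.

Definition map_facts (h : term -> term) (F : fact_set) : fact_set :=
  [fset map_atom h a | a in F].

Lemma firsts_map P h F : firsts P (map_facts h F) = h @` firsts P F.
Proof.
have headE (a : fact) : head (Const 0) (args (map_atom h a)) =
    h (head (Const 0) (args a)).
  by case: a => -[p n] u; case/tupleP: u.
apply/fsetP => x; apply/idP/idP.
  case/firstsP=> _ [/imfsetP[a /= aF ->] aP ->]; rewrite headE.
  by apply: in_imfset; apply/firstsP; exists a.
case/imfsetP=> _ /= /firstsP[a [aF aP ->]] ->; apply/firstsP.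
by exists (map_atom h a); split=> //; apply: in_imfset.
Qed.

Definition pending (F : fact_set) : {fset term} :=
  firsts (0, 0) F `\` firsts (binary 0) F.

(** The weight 2 outbalances the one null that a TGD step may add. *)
Definition measure (F : fact_set) : nat := 2 * #|` pending F| + #|` terms F|.

(** Every term pending afterwards is the image of a pending one, because the replacement carries
    P-successors along. Moreover [t] vanishes from the terms, whereas [u] was there already. *)
Lemma measure_replace t u F :
  t != u -> t \in terms F -> u \in terms F -> measure (replace t u F) < measure F.
Proof.
move=> tu tF uF; pose h v := if v == t then u else v.
have pendE : #|` pending (replace t u F)| <= #|` pending F|.
  have imE : #|` h @` pending F| <= #|` pending F| by exact: leq_imfset_card.
  apply: leq_trans imE; apply: fsubset_leq_card.
  rewrite /pending -/(map_facts h F) !firsts_map; apply/fsubsetP => x.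
  rewrite inE => /andP[xB /imfsetP[y /= yA xE]]; subst x.
  apply: in_imfset; rewrite /= inE yA andbT.
  by apply: contra xB => yB; apply: in_imfset.
have termE : #|` terms (replace t u F)| < #|` terms F|.
  rewrite (cardfsD1 t (terms F)) tF add1n ltnS; apply: fsubset_leq_card.
  apply/fsubsetP=> x /termsP[_ /imfsetP[a /= aF ->]].
  rewrite args_map_atom => /mapP[y ya ->]; rewrite in_fsetD1.
  have yF : y \in terms F by apply/termsP; exists a.
  by case: (eqVneq y t) => [_|->] //; rewrite eq_sym tu.
rewrite /measure; lia.
Qed.

Lemma measure_merge prec t u F :
  t != u -> t \in terms F -> u \in terms F ->
  measure (Defs.merge prec t u F) < measure F.
Proof.
by move=> tu tF uF; rewrite /Defs.merge; case: ifP => _;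
  apply: measure_replace; rewrite // eq_sym.
Qed.

Lemma inst_witness s :
  inst (skolem_ext witness_tgd s) witness_tgd.2 =
  [fset at2 0 (s 0) (Sk (witness_tgd, 1) [:: s 0])].
Proof.
apply/fsetP=> a; rewrite inE; apply/imfsetP/eqP => [[b /=]|->].
  by rewrite inE => /eqP -> ->; rewrite map_at2.
by exists (at2 0 0 1); rewrite /= ?inE ?map_at2.
Qed.

Lemma measure_witness F s :
  applicable F (inl witness_tgd) s ->
  measure (F `|` inst (skolem_ext witness_tgd s) witness_tgd.2) < measure F.
Proof.
case=> /inst_subP bodyF headF.
have sA : at1 (s 0) \in F by rewrite -map_at1; apply: bodyF; rewrite inE.
set n := Sk (witness_tgd, 1) [:: s 0].
rewrite inst_witness fsetUC -/n; set G := _ |` _.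
have sFA : s 0 \in firsts (0, 0) F by apply/firstsP; exists (at1 (s 0)).
have sFB : s 0 \notin firsts (binary 0) F.
  apply/negP=> /firstsP[a [aF /at2P[x [y aE]] sE]]; subst a; case: headF.
  (* A P-successor [y] of [s 0] would serve as the value of the existential variable 1 and satisfy
     the head. *)
  exists (fun v => if v == 1 then y else s 0); split.
    by move=> v; rewrite inE => /eqP->.
  by apply/inst_subP => a; rewrite inE => /eqP ->; rewrite map_at2 /= sE.
(* The added P-fact takes [s 0] out of the pending terms and makes no new A-term. *)
have pendE : #|` pending G| < #|` pending F|.
  rewrite (cardfsD1 (s 0) (pending F)) inE sFA sFB add1n ltnS.
  apply: fsubset_leq_card; apply/fsubsetP=> x.
  rewrite {1}/pending in_fsetD => /andP[xB /firstsP[a [aG aA xE]]].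
  rewrite in_fsetD1; apply/andP; split.
    apply: contra xB => /eqP->; apply/firstsP.
    by exists (at2 0 (s 0) n); rewrite fset1U1.
  rewrite in_fsetD; apply/andP; split.
    by apply: contra xB; apply/fsubsetP/firsts_sub/fsubsetU1.
  apply/firstsP; exists a; split=> //; move: aG; rewrite !inE => /orP[/eqP aE|//].
  by rewrite aE in aA.
have termE : #|` terms G| <= 1 + #|` terms F|.
  apply: (@leq_trans #|` n |` terms F|); last by rewrite cardfsU1; case: (n \notin _).
  apply: fsubset_leq_card; apply/fsubsetP=> x /termsP[a].
  rewrite /G !in_fset1U => /orP[/eqP ->|aF] xa; last first.
    by apply/orP; right; apply/termsP; exists a.
  move: xa; rewrite !in_cons orbF => /orP[] /eqP ->; last by rewrite eqxx.
  by apply/orP; right; apply/termsP; exists (at1 (s 0)); rewrite ?inE.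
rewrite /measure; lia.
Qed.

Lemma witness_terminates prec : chase_terminates prec witness_rules.
Proof.
move=> F0 [n|] F _; first by exists n.
case=> _ steps _.
have decr i : measure (F i.+1) < measure (F i).
  have [//|r [s [rR app ->]]] := steps i.
  move: rR app; rewrite !inE => /orP[] /eqP->; first exact: measure_witness.
  case=> /inst_subP bodyF /= xy.
  have sP : at2 0 (s 0) (s 1) \in F i by rewrite -map_at2; apply: bodyF; rewrite inE.
  by apply: measure_merge => //; apply/termsP; exists (at2 0 (s 0) (s 1));
    rewrite ?inE ?eqxx ?orbT.
have bound i : i + measure (F i) <= measure (F 0).
  by elim: i => // i IH; have := decr i; lia.
(* The bound fails at an index beyond the initial measure. *)
by have := bound (measure (F 0)).+1; lia.
Qed.

(** * Adding facts one by one with TGD steps *)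

Definition tgd_step (rs : seq rule) (F G : fact_set) : Prop :=
  exists d s, [/\ inl d \in rs, applicable F (inl d) s
                & G = F `|` inst (skolem_ext d s) d.2].

(** The fact may already be present: this asks for a body match of a single-head rule without
    existential variables, not for applicability. *)
Definition derives (rs : seq rule) (F : fact_set) (a : fact) : Prop :=
  exists B h s, [/\ inl (B, [:: h]) \in rs, {subset args h <= vars B},
                    inst s B `<=` F & a = map_atom s h].

Lemma eq_map_atom (s s' : subst) a :
  {in args a, s =1 s'} -> map_atom s a = map_atom s' a.
Proof. by move=> ss'; apply: atom_inj; rewrite // !args_map_atom; apply/eq_in_map. Qed.

Lemma derives_mono rs F G a : F `<=` G -> derives rs F a -> derives rs G a.
Proof.
move=> FG [B [h [s [rR hB BF ->]]]]; exists B, h, s; split=> //.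
exact: fsubset_trans BF FG.
Qed.

(** All variables of the head occur in the body. Hence every extension of the match, and also
    [skolem_ext], sends the head to [a] itself. *)
Lemma derives_step rs F a :
  derives rs F a -> a \notin F -> tgd_step rs F (a |` F).
Proof.
case=> B [h [s [rR hB BF ->]]] aF; exists (B, [:: h]), s; split=> //.
  split=> //; case=> s' [ss' /inst_subP hF].
  move: aF; rewrite -(@eq_map_atom s') ?hF ?inE //.
  by move=> v /hB; apply: ss'.
rewrite /= fsetUC; congr fsetU; apply/fsetP=> b; rewrite inE.
have extE : map_atom (skolem_ext (B, [:: h]) s) h = map_atom s h.
  apply: eq_map_atom => v /hB vB.
  by rewrite /skolem_ext mem_filter /= vB.
apply/eqP/imfsetP => [->|[c /=]]; first by exists h; rewrite /= ?inE.
by rewrite inE => /eqP -> ->.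
Qed.

Fixpoint steps rs (F : fact_set) (l : seq fact) : Prop :=
  if l is a :: l' then tgd_step rs F (a |` F) /\ steps rs (a |` F) l'
  else True.

Fixpoint derivs rs (F : fact_set) (l : seq fact) : Prop :=
  if l is a :: l' then derives rs F a /\ derivs rs (a |` F) l' else True.

Definition adds (F : fact_set) (l : seq fact) : fact_set :=
  foldl (fun G a => a |` G) F l.

(** Drops each fact that is present when its turn comes, as adding it would not be a chase step.
    This turns [derivs] into [steps]. *)
Fixpoint fresh (F : fact_set) (l : seq fact) : seq fact :=
  if l is a :: l' then
    if a \in F then fresh F l' else a :: fresh (a |` F) l'
  else [::].

Lemma mem_adds F l a : (a \in adds F l) = (a \in F) || (a \in l).
Proof.
elim: l F => [|b l IH] F; first by rewrite orbF.
by rewrite /= IH in_fset1U in_cons orbCA orbA.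
Qed.

Lemma adds_fresh F l : adds F (fresh F l) = adds F l.
Proof.
elim: l F => //= a l IH F; case: ifP => aF /=; rewrite IH //.
by rewrite mem_fset1U.
Qed.

Lemma steps_fresh rs F l : derivs rs F l -> steps rs F (fresh F l).
Proof.
elim: l F => //= a l IH F [Fa Fl]; case: ifP => aF.
  by apply: IH; rewrite mem_fset1U in Fl.
by split; [apply: derives_step; rewrite ?aF | apply: IH].
Qed.

Lemma derivs_all rs F l : {in l, forall a, derives rs F a} -> derivs rs F l.
Proof.
elim: l F => //= a l IH F Fl; split; first by apply: Fl; rewrite inE eqxx.
apply: IH => b bl; apply: derives_mono (fsubsetU1 _ _) _.
by apply: Fl; rewrite inE bl orbT.
Qed.

(** The second list is treated over an arbitrary superset [G], which by monotonicity spares any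
    description of the intermediate fact sets. *)
Lemma derivs_cat rs F l1 l2 :
  derivs rs F l1 ->
  (forall G, F `<=` G -> {subset l1 <= G} -> derivs rs G l2) ->
  derivs rs F (l1 ++ l2).
Proof.
elim: l1 F => [|a l1 IH] F /=; first by move=> _; apply.
case=> Fa Fl1 H; split=> //; apply: IH => // G FG l1G; apply: H.
  exact: fsubset_trans (fsubsetU1 _ _) FG.
move=> b; rewrite inE => /orP[/eqP ->|]; last exact: l1G.
by apply: (fsubsetP FG); rewrite fset1U1.
Qed.

(** * The axiomatised rule set and its Datalog consequences *)

Lemma St_witness e : St e witness_rules =
  [:: inl witness_tgd;
      inl ([:: at2 0 0 1], [:: at2 e 0 1]);
      inl ([:: at1 0], [:: at2 e 0 0]);
      inl ([:: at2 0 0 1], [:: at2 e 0 0; at2 e 1 1]);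
      inl ([:: at2 e 0 1], [:: at2 e 1 0]);
      inl ([:: at2 e 0 1; at2 e 1 2], [:: at2 e 0 2]);
      inl ([:: at1 0; at2 e 0 1], [:: at1 1]);
      inl ([:: at2 0 0 1; at2 e 0 2], [:: at2 0 2 1]);
      inl ([:: at2 0 0 1; at2 e 1 2], [:: at2 0 0 2])].
Proof.
have predsE : preds witness_rules = [:: (0, 0); binary 0] by [].
rewrite /St predsE /= /refl_rule /replacement_rule generic_at1 !generic_at2.
by rewrite map_at1 !map_at2.
Qed.

(** The index [k] selects a rule by its position in [St_witness]. The substitution sends 0 to [x], 1
    to [y] and all other variables, in particular 2, to [z]. *)
Lemma derives_St e F (x y z : term) k B h :
  nth (inl witness_tgd) (St e witness_rules) k = inl (B, [:: h]) ->
  k < 9 -> all [in vars B] (args h) ->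
  {in B, forall b, map_atom (nth z [:: x; y]) b \in F} ->
  derives (St e witness_rules) F (map_atom (nth z [:: x; y]) h).
Proof.
move=> kE k9 /allP hB BF; exists B, h, (nth z [:: x; y]); split=> //.
  by rewrite -kE mem_nth ?St_witness.
exact/inst_subP.
Qed.

Lemma derives_collapse e F x y :
  at2 0 x y \in F -> derives (St e witness_rules) F (at2 e x y).
Proof.
move=> xy; have := @derives_St e F x y y 1; rewrite St_witness => /(_ _ _ erefl).
by rewrite map_at2; apply=> // b; rewrite inE => /eqP ->; rewrite map_at2.
Qed.

Lemma derives_refl e F x :
  at1 x \in F -> derives (St e witness_rules) F (at2 e x x).
Proof.
move=> xF; have := @derives_St e F x x x 2; rewrite St_witness => /(_ _ _ erefl).
by rewrite map_at2; apply=> // b; rewrite inE => /eqP ->; rewrite map_at1.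
Qed.

Lemma derives_sym e F x y :
  at2 e x y \in F -> derives (St e witness_rules) F (at2 e y x).
Proof.
move=> xy; have := @derives_St e F x y y 4; rewrite St_witness => /(_ _ _ erefl).
by rewrite map_at2; apply=> // b; rewrite inE => /eqP ->; rewrite map_at2.
Qed.

Lemma derives_trans e F x y z :
  at2 e x y \in F -> at2 e y z \in F ->
  derives (St e witness_rules) F (at2 e x z).
Proof.
move=> xy yz; have := @derives_St e F x y z 5; rewrite St_witness => /(_ _ _ erefl).
by rewrite map_at2; apply=> // b; rewrite !inE => /orP[] /eqP ->; rewrite map_at2.
Qed.

Lemma derives_at1 e F x y :
  at1 x \in F -> at2 e x y \in F -> derives (St e witness_rules) F (at1 y).
Proof.
move=> xF xy; have := @derives_St e F x y y 6; rewrite St_witness => /(_ _ _ erefl).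
by rewrite map_at1; apply=> // b; rewrite !inE => /orP[] /eqP ->;
  rewrite ?map_at1 ?map_at2.
Qed.

Lemma derives_at2 e F x y z :
  at2 0 x y \in F -> at2 e y z \in F ->
  derives (St e witness_rules) F (at2 0 x z).
Proof.
move=> xy yz; have := @derives_St e F x y z 8; rewrite St_witness => /(_ _ _ erefl).
by rewrite map_at2; apply=> // b; rewrite !inE => /orP[] /eqP ->; rewrite map_at2.
Qed.

(** * The nulls and the stages of the infinite chase *)

Definition null (n : nat) : term :=
  iter n (fun t => Sk (witness_tgd, 1) [:: t]) (Const 0).

(** The depth of [null n] is [n]. *)
Lemma null_inj : injective null.
Proof.
have depth_null n : depth (null n) = n by elim: n => //= n ->; rewrite maxn0.
by move=> m n /(congr1 depth); rewrite !depth_null.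
Qed.

Lemma at2_inj p q (x y x' y' : term) :
  at2 p x y = at2 q x' y' -> [/\ p = q, x = x' & y = y'].
Proof.
move=> E; have /= [pq] := congr1 (@tag _ _) E.
by have /= [-> ->] := congr1 (@args term) E.
Qed.

Lemma at1_at2 p (x y z : term) : at1 x <> at2 p y z.
Proof. by move/(congr1 (@tag _ _)). Qed.

(* The last clause keeps the TGD applicable to [null n]. *)
Definition saturated e n (F : fact_set) : Prop :=
  [/\ forall i, i <= n -> at1 (null i) \in F,
      forall i j, i <= n -> j <= n -> at2 e (null i) (null j) \in F,
      forall i j, i < n -> j <= n -> at2 0 (null i) (null j) \in F
    & forall i y, at2 0 (null i) y \in F -> i < n].

(* The order matters: each fact follows in one step from facts that precede it
   or were present before the stage. *)
Definition stage e n : seq fact :=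
  [:: at2 e (null n) (null n.+1); at1 (null n.+1)]
  ++ [seq at2 e (null i) (null n.+1) | i <- iota 0 n.+1]
  ++ [seq at2 e (null n.+1) (null i) | i <- iota 0 n.+1]
  ++ [:: at2 e (null n.+1) (null n.+1)]
  ++ [seq at2 0 (null i) (null n.+1) | i <- iota 0 n]
  ++ [seq at2 0 (null n) (null j) | j <- iota 0 n.+2].

(** Kept apart from [stage] because it comes from the existential TGD, not from a Datalog rule. *)
Definition new_null n : fact := at2 0 (null n) (null n.+1).

(** The new null is equated with [null n] by the relaxed EGD, becomes an A-term by replacement, and
    is equated with the older nulls by transitivity through [null n] and symmetry. The P-facts then
    follow by replacing second arguments. *)
Lemma derivs_stage e n F :
  saturated e n F -> derivs (St e witness_rules) (new_null n |` F) (stage e n).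
Proof.
case=> sA sE sP _; set G := _ |` F.
have FG : F `<=` G by exact: fsubsetU1.
have nG : new_null n \in G by rewrite fset1U1.
apply: derivs_cat => [|G1 GG1 l1].
  split; first exact: derives_collapse.
  split=> //; apply: (@derives_at1 _ _ (null n)); last by rewrite fset1U1.
  by rewrite fset1Ur // (fsubsetP FG) // sA.
have {}FG1 := fsubsetP (fsubset_trans FG GG1).
have en : at2 e (null n) (null n.+1) \in G1 by apply: l1; rewrite inE eqxx.
apply: derivs_cat => [|G2 /fsubsetP G12 l2].
  apply: derivs_all => a /mapP[i]; rewrite mem_iota ltnS => /= ni ->.
  by apply: (derives_trans _ en); apply/FG1/sE.
apply: derivs_cat => [|G3 /fsubsetP G23 l3].
  apply: derivs_all => a /mapP[i ni ->].
  by apply/derives_sym/l2/mapP; exists i.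
apply: derivs_cat => [|G4 /fsubsetP G34 l4].
  split=> //; apply: (@derives_trans _ _ _ (null n)); last by apply/G23/G12.
  by apply/l3/mapP; exists n; rewrite ?mem_iota ?ltnS /=.
have e4 : at2 e (null n) (null n.+1) \in G4 by apply/G34/G23/G12.
have F4 a : a \in F -> a \in G4 by move=> aF; apply/G34/G23/G12/FG1.
have n4 : new_null n \in G4 by apply/G34/G23/G12/(fsubsetP GG1).
have e4' i : i <= n.+1 -> at2 e (null n.+1) (null i) \in G4.
  rewrite leq_eqVlt => /orP[/eqP->|ni]; first by apply: l4; rewrite inE.
  by apply/G34/l3/mapP; exists i; rewrite ?mem_iota.
apply: derivs_cat => [|G5 /fsubsetP G45 _].
  apply: derivs_all => a /mapP[i]; rewrite mem_iota => /= ni ->.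
  by apply: (derives_at2 _ e4); apply/F4/sP.
(* All these facts come from [new_null n] itself, by replacing [null n.+1] with [null i]. *)
apply: derivs_all => a /mapP[i]; rewrite mem_iota ltnS => /= ni ->.
by apply: derives_at2; apply: G45; [exact: n4|exact: e4'].
Qed.

Lemma saturated_stage e n F : e != 0 ->
  saturated e n F -> saturated e n.+1 (adds (new_null n |` F) (stage e n)).
Proof.
move=> e0 [sA sE sP sU]; set G := adds _ _.
have FG a : a \in F -> a \in G by move=> aF; rewrite mem_adds fset1Ur.
have lG a : a \in stage e n -> a \in G by move=> al; rewrite mem_adds al orbT.
split.
- move=> i; rewrite leq_eqVlt => /orP[/eqP->|/sA/FG//].
  by apply: lG; rewrite !inE eqxx orbT.
- move=> i j; rewrite leq_eqVlt => /orP[/eqP->|ni].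
    rewrite leq_eqVlt => /orP[/eqP->|nj]; apply: lG; rewrite !mem_cat.
      by rewrite !inE eqxx !orbT.
    do 2 (apply/orP; right); apply/orP; left.
    by apply/mapP; exists j; rewrite ?mem_iota.
  rewrite leq_eqVlt => /orP[/eqP->|nj]; last exact/FG/sE.
  apply: lG; rewrite !mem_cat; apply/orP; right; apply/orP; left.
  by apply/mapP; exists i; rewrite ?mem_iota.
- move=> i j; rewrite ltnS leq_eqVlt => /orP[/eqP->|ni] nj.
    apply: lG; rewrite !mem_cat; do 5 (apply/orP; right).
    by apply/mapP; exists j; rewrite ?mem_iota.
  move: nj; rewrite leq_eqVlt => /orP[/eqP->|nj]; last exact/FG/sP.
  apply: lG; rewrite !mem_cat; do 4 (apply/orP; right); apply/orP; left.
  by apply/mapP; exists i; rewrite ?mem_iota.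
(* Since [e != 0], EQ-facts are not P-facts, and all P-facts of the stage start at [null n] or
   earlier: the TGD stays applicable to [null n.+1]. *)
move=> i y; rewrite mem_adds in_fset1U -orbA => /or3P[/eqP|/sU|].
- by rewrite /new_null => /at2_inj[_ /null_inj -> _].
- exact: leqW.
have ne x z : at2 0 (null i) y <> at2 e x z.
  by move=> /at2_inj[E _ _]; rewrite -E in e0.
have ne1 x : at2 0 (null i) y <> at1 x by move/esym/at1_at2.
rewrite !mem_cat; case/orP; first by rewrite !inE => /orP[]/eqP; [move/ne|move/ne1].
case/orP => [/mapP[? _ /ne //]|]; case/orP => [/mapP[? _ /ne //]|].
case/orP => [|]; first by rewrite inE => /eqP/ne.
case/orP => /mapP[j]; rewrite mem_iota => /= nj /at2_inj[_ /null_inj -> _] //.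
exact: leqW.
Qed.

(** * The infinite chase sequence, and the facts over the nulls that it runs through *)

Definition in_orbit e (a : fact) : Prop :=
  tag a \in [:: (0, 0); binary 0; binary e] /\
  (forall x, x \in args a -> exists k, x = null k).

Lemma in_orbit1 e i : in_orbit e (at1 (null i)).
Proof. by split=> // x; rewrite inE => /eqP->; exists i. Qed.

Lemma in_orbit2 e p i j :
  p \in [:: 0; e] -> in_orbit e (at2 p (null i) (null j)).
Proof.
move=> pe; split; last by move=> x; rewrite !inE => /orP[] /eqP->; [exists i | exists j].
by move: pe; rewrite !inE => /orP[] /eqP->; rewrite eqxx ?orbT.
Qed.

Lemma stage_in_orbit e n : {in stage e n, forall a, in_orbit e a}.
Proof.
have eO i j : in_orbit e (at2 e (null i) (null j)).
  by apply: in_orbit2; rewrite !inE eqxx orbT.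
have pO i j : in_orbit e (at2 0 (null i) (null j)) by apply: in_orbit2.
move=> a; rewrite !mem_cat.
case/orP; first by rewrite !inE => /orP[]/eqP->; [exact: eO|exact: in_orbit1].
do 2 (case/orP => [/mapP[i _ ->]|]; first exact: eO).
case/orP; first by rewrite inE => /eqP->; exact: eO.
by case/orP => /mapP[i _ ->]; exact: pO.
Qed.

Lemma saturated_orbit e a : in_orbit e a ->
  exists n0, forall n F, n0 <= n -> saturated e n F -> a \in F.
Proof.
case=> tagE argsE.
have [aE|[p [pe aE]]] : tag a = (0, 0) \/ exists p, p \in [:: 0; e] /\ tag a = binary p.
  move: tagE; rewrite !inE => /or3P[] /eqP ->; first by left.
    by right; exists 0.
  by right; exists e; rewrite !inE eqxx orbT.
  have [x aE1] := at1P aE; subst a.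
  have [|i ->] := argsE x; first by rewrite inE.
  by exists i => n F ni [sA _ _ _]; apply: sA.
have [x [y aE2]] := at2P aE; subst a.
have [|i ->] := argsE x; first by rewrite inE eqxx.
have [|j ->] := argsE y; first by rewrite !inE eqxx orbT.
(* The successor is due to the P-clause of [saturated], which is strict in the first index. *)
exists (i + j).+1 => n F nij [_ sE sP _].
by move: pe; rewrite !inE => /orP[] /eqP ->; [apply: sP | apply: sE]; lia.
Qed.

(* A stage number, the facts still to be added in this stage, and the current
   fact set. *)
Definition state : Type := (nat * seq fact * fact_set)%type.

(** Each call adds one fact, so that it can be matched with one chase step. *)
Definition next e (x : state) : state :=
  let: (n, l, F) := x in
  if l is a :: l' then (n, l', a |` F) else
  let G := new_null n |` F in (n.+1, fresh G (stage e n), G).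

(** Saturation is claimed for the set reached once the queue [l] is used up, since it may fail in
    the middle of a stage. *)
Definition valid e (x : state) : Prop :=
  let: (n, l, F) := x in
  [/\ steps (St e witness_rules) F l, saturated e n (adds F l)
    & {in adds F l, forall a, in_orbit e a}].

(** A P-successor of [null n] in [F] would give [n < n] by the last clause of [saturated]. *)
Lemma step_new_null e n F : saturated e n F ->
  tgd_step (St e witness_rules) F (new_null n |` F).
Proof.
case=> sA _ _ sU; exists witness_tgd, (fun=> null n); split.
- by rewrite St_witness inE eqxx.
- split; first by apply/inst_subP => a; rewrite inE => /eqP->; rewrite map_at1 sA.
  case=> s' [ss' /inst_subP sF].
  have := sF (at2 0 0 1); rewrite inE map_at2 ss' // => /(_ (eqxx _))/sU.
  by rewrite ltnn.
- by rewrite /= inst_witness fsetUC.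
Qed.

Lemma next_valid e x : e != 0 -> valid e x ->
  tgd_step (St e witness_rules) x.2 (next e x).2 /\ valid e (next e x).
Proof.
move=> e0; case: x => -[n [|a l]] F [Fl sat orb]; last by case: Fl.
split; first exact: step_new_null.
split; first exact/steps_fresh/derivs_stage.
  by rewrite adds_fresh; apply: saturated_stage.
move=> a; rewrite adds_fresh mem_adds in_fset1U -orbA.
case/or3P => [/eqP->|/orb //|/stage_in_orbit //].
exact: in_orbit2.
Qed.

(** The queued fact follows by reflexivity and completes saturation at level 0. *)
Definition start e : state :=
  (0, [:: at2 e (null 0) (null 0)], [fset at1 (null 0)]).

Lemma start_valid e : e != 0 -> valid e (start e).
Proof.
move=> e0.
have startE a : a \in adds [fset at1 (null 0)] [:: at2 e (null 0) (null 0)] ->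
    a = at1 (null 0) \/ a = at2 e (null 0) (null 0).
  by rewrite mem_adds !inE => /orP[] /eqP; [left|right].
split.
- split=> //; apply: derives_step; last by rewrite inE; apply/eqP => /esym/at1_at2.
  by apply: derives_refl; rewrite inE.
- split=> //.
  + by move=> i; rewrite leqn0 => /eqP->; rewrite mem_adds !inE eqxx.
  + move=> i j; rewrite !leqn0 => /eqP-> /eqP->.
    by rewrite mem_adds !inE eqxx orbT.
  + move=> i y /startE[/esym/at1_at2 //|/at2_inj[E _ _]].
    by rewrite -E in e0.
- move=> a /startE[]->; first exact: in_orbit1.
  by apply: in_orbit2; rewrite !inE eqxx orbT.
Qed.

Definition run e i : state := iter i (next e) (start e).

Lemma run_valid e i : e != 0 -> valid e (run e i).
Proof.
move=> e0; elim: i => [|i IH]; first exact: start_valid.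
by have [] := next_valid e0 IH.
Qed.

Lemma run_saturated e n : e != 0 -> exists i, saturated e n (run e i).2.
Proof.
move=> e0; have flush m l F :
    iter (size l) (next e) (m, l, F) = (m, [::], adds F l).
  by elim: l F => // a l IH F; rewrite [size _]/= iterSr IH.
have [i iE] : exists i, (run e i).1 = (n, [::]).
  elim: n => [|n [i]]; first by exists 1.
  case iE: (run e i) => [[m l] F] [mE lE]; subst m l.
  (* One step opens the next stage, and as many steps as its queue is long finish it. *)
  exists (size (fresh (new_null n |` F) (stage e n)) + i.+1)%N.
  by rewrite /run iterD iterS -/(run e i) iE /= flush.
exists i; have := run_valid i e0.
by case: (run e i) iE => -[m l] F /= [-> ->] /= [].
Qed.

Lemma run_mono e i j : i <= j -> (run e i).2 `<=` (run e j).2.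
Proof.
elim: j => [|j IH]; first by rewrite leqn0 => /eqP->.
rewrite leq_eqVlt => /orP[/eqP->//|/IH ij]; apply: fsubset_trans ij _.
by rewrite /run iterS -/(run e j); case: (run e j) => -[m [|a l]] F /=;
  apply: fsubsetU1.
Qed.

Lemma run_in_orbit e i : e != 0 -> {in (run e i).2, forall a, in_orbit e a}.
Proof.
move=> e0; have := run_valid i e0.
by case: (run e i) => -[n l] F /= [_ _ orb] a aF; apply: orb; rewrite mem_adds aF.
Qed.

(** * Fairness and the conclusion *)

Lemma run_orbit e (A : seq fact) : e != 0 -> {in A, forall a, in_orbit e a} ->
  exists i, {subset A <= (run e i).2}.
Proof.
move=> e0; elim: A => [|a A IH] AO; first by exists 0.
have [|i Ai] := IH; first by move=> b bA; apply: AO; rewrite inE bA orbT.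
have [|n aS] := @saturated_orbit e a; first by apply: AO; rewrite inE eqxx.
have [j /aS aj] := run_saturated n e0.
exists (maxn i j) => b; rewrite inE => /orP[/eqP->|/Ai].
  by apply: (fsubsetP (run_mono e (leq_maxr i j))); apply: aj.
exact: (fsubsetP (run_mono e (leq_maxl i j))).
Qed.

(** Heads may have several atoms here, as in the reflexivity rule for P. The condition on tags keeps
    their instances over nulls in the orbit. *)
Definition datalog e (r : rule) : bool :=
  if r is inl (B, H) then
    all (fun h => (tag h \in [:: (0, 0); binary 0; binary e])
                  && all [in vars B] (args h)) H
  else false.

Lemma St_datalog e r :
  r \in St e witness_rules -> r = inl witness_tgd \/ datalog e r.
Proof.
rewrite St_witness in_cons => /orP[/eqP->|]; first by left.
by move=> rS; right; move: r rS; apply/allP; rewrite /= ?inE ?eqxx ?orbT.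
Qed.

(** The match sends body variables to nulls, so some instance of the head consists of finitely many
    orbit facts. Once all of them have appeared, the head is satisfied. *)
Lemma run_fair e r s i : e != 0 -> r \in St e witness_rules ->
  inst s (body r) `<=` (run e i).2 ->
  exists2 j, i <= j & ~ applicable (run e j).2 r s.
Proof.
move=> e0 /St_datalog rE /inst_subP bodyF.
have orb a v : a \in body r -> v \in args a -> exists k, s v = null k.
  move=> /bodyF/(run_in_orbit e0)[_ argsE] va.
  by apply: argsE; rewrite args_map_atom map_f.
case: rE bodyF orb => [-> _ orb|].
  have [||k sE] := orb (at1 0) 0; rewrite ?inE //.
  have [|j Aj] := @run_orbit e [:: at2 0 (null k) (null k.+1)] e0.
    by move=> a; rewrite inE => /eqP->; apply: in_orbit2.
  exists (maxn i j); rewrite ?leq_maxl // => -[_]; apply.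
  (* The existential variable is sent to the null that the TGD would create for [null k]. *)
  exists (fun v => if v == 1 then null k.+1 else s v); split.
    by move=> v; rewrite inE => /eqP->.
  apply/inst_subP => a; rewrite inE => /eqP->; rewrite map_at2 /= sE.
  by apply: (fsubsetP (run_mono e (leq_maxr i j))); apply: Aj; rewrite inE.
case: r => [[B H]|//] /= /allP dlog _ orb.
have [|j Aj] := @run_orbit e (map (map_atom s) H) e0.
  move=> _ /mapP[h /dlog/andP[tagE /allP hB] ->]; split=> // x.
  rewrite args_map_atom => /mapP[v /hB/flatten_mapP[a aB va] ->].
  exact: orb aB va.
exists (maxn i j); rewrite ?leq_maxl // => -[_]; apply; exists s; split=> //.
apply/inst_subP => a aH; apply: (fsubsetP (run_mono e (leq_maxr i j))).
by apply: Aj; apply: map_f.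
Qed.

Theorem theorem2 (prec : rel term) (prec_order : term_order prec) :
  exists R : seq rule,
    [/\ all wf_rule R,
        chase_terminates prec R
      & forall e : nat, binary e \notin preds R ->
          ~ chase_terminates prec (St e R)].
Proof.
exists witness_rules; split=> //; first exact: witness_terminates.
move=> e eR term_St.
(* For [e = 0] the predicate [binary e] would be P, which occurs in the rules. *)
have e0 : e != 0 by apply: contra eR => /eqP->.
have [||n //] := term_St [fset at1 (null 0)] None (fun i => (run e i).2).
  by move=> a; rewrite inE => /eqP->.
split=> // [i _|r s i rR _ [bodyF _]].
  have [[d [s [dR app nextE]]] _] := next_valid e0 (run_valid i e0).
  by exists (inl d), s; split.
by have [j ij na] := run_fair e0 rR bodyF; exists j.
Qed.
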